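(* Let $(\mathfrak g,\mathfrak h,\rho,\psi)$ be a matched pair of 3-Lie algebras over a field $\mathbf k$ and let $(V,W,\alpha,\beta)$ be a representation of it, with action maps $\rho_V,\psi_V,\rho_W,\psi_W$. Let $\mathfrak g\ltimes V$ be the 3-Lie algebra $\mathfrak g\oplus V$ with bracket $$[(x_1,v_1),(x_2,v_2),(x_3,v_3)]=\big([x_1,x_2,x_3],\ \rho_V(x_1,x_2)v_3+\rho_V(x_3,x_1)v_2+\rho_V(x_2,x_3)v_1\big),$$ and let $\mathfrak h\ltimes W$ be the 3-Lie algebra $\mathfrak h\oplus W$ with bracket $$[(a_1,w_1),(a_2,w_2),(a_3,w_3)]=\big([a_1,a_2,a_3],\ \psi_W(a_1,a_2)w_3+\psi_W(a_3,a_1)w_2+\psi_W(a_2,a_3)w_1\big).$$ Define $$(\rho\ltimes\alpha)((x_1,v_1),(x_2,v_2))(a_1,w_1)=\big(\rho(x_1,x_2)a_1,\ \rho_W(x_1,x_2)w_1+(\alpha(v_1,x_2)-\alpha(v_2,x_1))a_1\big),$$ $$(\psi\ltimes\beta)((a_1,w_1),(a_2,w_2))(x_1,v_1)=\big(\psi(a_1,a_2)x_1,\ \psi_V(a_1,a_2)v_1+(\beta(w_1,a_2)-\beta(w_2,a_1))x_1\big).$$ Then $(\mathfrak g\ltimes V,\ \mathfrak h\ltimes W,\ \rho\ltimes\alpha,\ \psi\ltimes\beta)$ is a matched pair of 3-Lie algebras.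
   Context: A 3-Lie algebra is a vector space $\mathfrak g$ with a linear map $[\cdot,\cdot,\cdot]:\wedge^3\mathfrak g\to\mathfrak g$ satisfying $[x_1,x_2,[y_1,y_2,y_3]]=[[x_1,x_2,y_1],y_2,y_3]+[y_1,[x_1,x_2,y_2],y_3]+[y_1,y_2,[x_1,x_2,y_3]]$. A representation of a 3-Lie algebra $\mathfrak g$ on $V$ is a map $\rho_V:\mathfrak g\times\mathfrak g\times V\to V$, trilinear and alternating in the first two arguments, with $\rho_V(x_1,x_2)\rho_V(x_3,x_4)-\rho_V(x_3,x_4)\rho_V(x_1,x_2)=\rho_V([x_1,x_2,x_3],x_4)+\rho_V(x_3,[x_1,x_2,x_4])$ and $\rho_V([x_1,x_2,x_3],x_4)=\rho_V(x_1,x_2)\rho_V(x_3,x_4)+\rho_V(x_2,x_3)\rho_V(x_1,x_4)+\rho_V(x_3,x_1)\rho_V(x_2,x_4)$. A matched pair of 3-Lie algebras is a quadruple $(\mathfrak g,\mathfrak h,\rho,\psi)$ with $\mathfrak g,\mathfrak h$ 3-Lie algebras and trilinear maps $\rho:\mathfrak g\times\mathfrak g\times\mathfrak h\to\mathfrak h$, $\psi:\mathfrak h\times\mathfrak h\times\mathfrak g\to\mathfrak g$, alternating in the first two arguments, such that for all $x_i\in\mathfrak g$, $a_i\in\mathfrak h$: (M1) $\psi(a_1,a_2)[x_1,x_2,x_3]=[\psi(a_1,a_2)x_1,x_2,x_3]+[x_1,\psi(a_1,a_2)x_2,x_3]+[x_1,x_2,\psi(a_1,a_2)x_3]$; (M2)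 $-\psi(\rho(x_1,x_2)a_1,a_2)x_3=-\psi(\rho(x_1,x_3)a_2,a_1)x_2+\psi(\rho(x_2,x_3)a_2,a_1)x_1-[x_1,x_2,\psi(a_1,a_2)x_3]$; (M3) $[\psi(a_1,a_2)x_1,x_2,x_3]=\psi(a_1,a_2)[x_1,x_2,x_3]+\psi(\rho(x_2,x_3)a_1,a_2)x_1+\psi(a_1,\rho(x_2,x_3)a_2)x_1$; (M4) $\rho(x_1,x_2)[a_1,a_2,a_3]=[\rho(x_1,x_2)a_1,a_2,a_3]+[a_1,\rho(x_1,x_2)a_2,a_3]+[a_1,a_2,\rho(x_1,x_2)a_3]$; (M5) $-\rho(\psi(a_1,a_2)x_1,x_2)a_3=-\rho(\psi(a_1,a_3)x_2,x_1)a_2+\rho(\psi(a_2,a_3)x_2,x_1)a_1-[a_1,a_2,\rho(x_1,x_2)a_3]$; (M6) $[\rho(x_1,x_2)a_1,a_2,a_3]=\rho(x_1,x_2)[a_1,a_2,a_3]+\rho(\psi(a_2,a_3)x_1,x_2)a_1+\rho(x_1,\psi(a_2,a_3)x_2)a_1$. A representation of the matched pair $(\mathfrak g,\mathfrak h,\rho,\psi)$ is a quadruple $(V,W,\alpha,\beta)$ where $V$ is a representation of $\mathfrak g$ (via $\rho_V$) and of $\mathfrak h$ (via $\psi_V$), $W$ is a representation of $\mathfrak g$ (via $\rho_W$) and of $\mathfrak h$ (via $\psi_W$), and $\alpha:V\times\mathfrak g\to\mathrm{Hom}(\mathfrak h,W)$, $\beta:W\times\mathfrak h\to\mathrm{Hom}(\mathfrak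 g,V)$ are bilinear maps such that for all $x_i\in\mathfrak g$, $a_i\in\mathfrak h$, $v,v_i\in V$, $w,w_i\in W$ the following hold. (R1) $\psi_V(a_1,a_2)\rho_V(x_1,x_2)v=\rho_V(\psi(a_1,a_2)x_1,x_2)v+\rho_V(x_1,\psi(a_1,a_2)x_2)v+\rho_V(x_1,x_2)\psi_V(a_1,a_2)v$. (R2) With $B=\beta(w_1,a_2)-\beta(w_2,a_1)$: $B[x_1,x_2,x_3]=\rho_V(x_2,x_3)Bx_1+\rho_V(x_3,x_1)Bx_2+\rho_V(x_1,x_2)Bx_3$. (R3) $\rho_V(x_1,\psi(a_1,a_2)x_2)v=\psi_V(\rho(x_1,x_2)a_2,a_1)v$. (R4) $\rho_V(x_1,x_2)\psi_V(a_1,a_2)v=\psi_V(\rho(x_1,x_2)a_1,a_2)v$. (R5) $\rho_V(x_1,x_2)(\beta(w_1,a_2)-\beta(w_2,a_1))x_3=\beta(\rho_W(x_2,x_3)w_2+(\alpha(v_2,x_3)-\alpha(v_3,x_2))a_2,a_1)x_1-\beta(w_1,\rho(x_2,x_3)a_2)x_1-\beta(\rho_W(x_1,x_3)w_2+(\alpha(v_1,x_3)-\alpha(v_3,x_1))a_2,a_1)x_2+\beta(w_1,\rho(x_1,x_3)a_2)x_2+\beta(\rho_W(x_1,x_2)w_1+(\alpha(v_1,x_2)-\alpha(v_2,x_1))a_1,a_2)x_3-\beta(w_2,\rho(x_1,x_2)a_1)x_3$. (R6) $\rho_V(x_1,x_2)\psi_V(a_1,a_2)v=\psi_V(a_1,a_2)\rho_V(x_1,x_2)v+\psi_V(\rho(x_1,x_2)a_1,a_2)v+\psi_V(a_1,\rho(x_1,x_2)a_2)v$.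 (R7) $\rho_V(x_2,x_3)(\beta(w_1,a_2)-\beta(w_2,a_1))x_1=(\beta(w_1,a_2)-\beta(w_2,a_1))[x_1,x_2,x_3]-\beta(w_2,\rho(x_2,x_3)a_1)x_1+\beta(w_1,\rho(x_2,x_3)a_2)x_1+\beta(\rho_W(x_2,x_3)w_1+(\alpha(v_2,x_3)-\alpha(v_3,x_2))a_1,a_2)x_1-\beta(\rho_W(x_2,x_3)w_2+(\alpha(v_2,x_3)-\alpha(v_3,x_2))a_2,a_1)x_1$. (R8) $\rho_V(\psi(a_1,a_2)x_1,x_2)v=\psi_V(a_1,a_2)\rho_V(x_1,x_2)v$. (R9) $\rho_W(x_1,x_2)\psi_W(a_1,a_2)w=\psi_W(\rho(x_1,x_2)a_1,a_2)w+\psi_W(a_1,\rho(x_1,x_2)a_2)w+\psi_W(a_1,a_2)\rho_W(x_1,x_2)w$. (R10) With $A=\alpha(v_1,x_2)-\alpha(v_2,x_1)$: $A[a_1,a_2,a_3]=\psi_W(a_2,a_3)Aa_1+\psi_W(a_3,a_1)Aa_2+\psi_W(a_1,a_2)Aa_3$. (R11) $\psi_W(a_1,\rho(x_1,x_2)a_2)w=\rho_W(\psi(a_1,a_2)x_2,x_1)w$. (R12) $\psi_W(a_1,a_2)\rho_W(x_1,x_2)w=\rho_W(\psi(a_1,a_2)x_1,x_2)w$. (R13) $\psi_W(a_1,a_2)(\alpha(v_1,x_2)-\alpha(v_2,x_1))a_3=\alpha(\psi_V(a_2,a_3)v_2+(\beta(w_2,a_3)-\beta(w_3,a_2))x_2,x_1)a_1-\alpha(v_1,\psi(a_2,a_3)x_2)a_1-\alpha(\psi_V(a_1,a_3)v_2+(\beta(w_1,a_3)-\beta(w_3,a_1))x_2,x_1)a_2+\alpha(v_1,\psi(a_1,a_3)x_2)a_2+\alpha(\psi_V(a_1,a_2)v_1+(\beta(w_1,a_2)-\beta(w_2,a_1))x_1,x_2)a_3-\alpha(v_2,\psi(a_1,a_2)x_1)a_3$.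 (R14) $\psi_W(a_1,a_2)\rho_W(x_1,x_2)w=\rho_W(x_1,x_2)\psi_W(a_1,a_2)w+\rho_W(\psi(a_1,a_2)x_1,x_2)w+\rho_W(x_1,\psi(a_1,a_2)x_2)w$. (R15) $\psi_W(a_2,a_3)(\alpha(v_1,x_2)-\alpha(v_2,x_1))a_1=(\alpha(v_1,x_2)-\alpha(v_2,x_1))[a_1,a_2,a_3]-\alpha(v_2,\psi(a_2,a_3)x_1)a_1+\alpha(v_1,\psi(a_2,a_3)x_2)a_1+\alpha(\psi_V(a_2,a_3)v_1+(\beta(w_2,a_3)-\beta(w_3,a_2))x_1,x_2)a_1-\alpha(\psi_V(a_2,a_3)v_2+(\beta(w_2,a_3)-\beta(w_3,a_2))x_2,x_1)a_1$. (R16) $\psi_W(\rho(x_1,x_2)a_1,a_2)w=\rho_W(x_1,x_2)\psi_W(a_1,a_2)w$. *)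

(* Defs.v *)
From HB Require Import structures.
From mathcomp Require Import all_boot all_order all_algebra.
Set Implicit Arguments.
Unset Strict Implicit.
Unset Printing Implicit Defensive.
Import GRing.Theory.
Local Open Scope ring_scope.

(* Vector spaces are [lmodType k] for a field [k], of arbitrary dimension.
   A trilinear map is a curried function linear in each argument, so [rho x y]
   is the operator rho(x,y), and a bilinear map into Hom(C, D) is the same
   thing as a map satisfying [trilinear]. *)
Definition trilinear (k : fieldType) (A B C D : lmodType k)
    (f : A -> B -> C -> D) : Prop :=
  [/\ forall b c, linear (fun a => f a b c),
      forall a c, linear (fun b => f a b c)
    & forall a b, linear (fun c => f a b c)].

(* "Alternating" is vanishing on repeated arguments, in every characteristic. *)
Definition alternating12 (k : fieldType) (A C D : lmodType k)
    (f : A -> A -> C -> D) : Prop :=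
  forall a c, f a a c = 0.

(* A linear map on the third exterior power is given by an alternating
   trilinear bracket. *)
Record is_3Lie (k : fieldType) (g : lmodType k) (br : g -> g -> g -> g) :
    Prop := Is3Lie {
  lie3_trilinear : trilinear br;
  lie3_alt12 : forall x y, br x x y = 0;
  lie3_alt13 : forall x y, br x y x = 0;
  lie3_alt23 : forall x y, br y x x = 0;
  lie3_fundamental : forall x1 x2 y1 y2 y3,
    br x1 x2 (br y1 y2 y3) =
      br (br x1 x2 y1) y2 y3 + br y1 (br x1 x2 y2) y3 + br y1 y2 (br x1 x2 y3)
}.

Record is_representation (k : fieldType) (g V : lmodType k)
    (br : g -> g -> g -> g) (rhoV : g -> g -> V -> V) :
    Prop := IsRepresentation {
  rep_trilinear : trilinear rhoV;
  rep_alt : alternating12 rhoV;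
  rep_comm : forall x1 x2 x3 x4 v,
    rhoV x1 x2 (rhoV x3 x4 v) - rhoV x3 x4 (rhoV x1 x2 v) =
      rhoV (br x1 x2 x3) x4 v + rhoV x3 (br x1 x2 x4) v;
  rep_bracket : forall x1 x2 x3 x4 v,
    rhoV (br x1 x2 x3) x4 v =
      rhoV x1 x2 (rhoV x3 x4 v) + rhoV x2 x3 (rhoV x1 x4 v)
      + rhoV x3 x1 (rhoV x2 x4 v)
}.

Record is_matched_pair (k : fieldType) (g h : lmodType k)
    (brg : g -> g -> g -> g) (brh : h -> h -> h -> h)
    (rho : g -> g -> h -> h) (psi : h -> h -> g -> g) :
    Prop := IsMatchedPair {
  mp_3Lie_l : is_3Lie brg;
  mp_3Lie_r : is_3Lie brh;
  mp_rho_trilinear : trilinear rho;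
  mp_rho_alt : alternating12 rho;
  mp_psi_trilinear : trilinear psi;
  mp_psi_alt : alternating12 psi;
  mp_M1 : forall x1 x2 x3 a1 a2,
    psi a1 a2 (brg x1 x2 x3) =
      brg (psi a1 a2 x1) x2 x3 + brg x1 (psi a1 a2 x2) x3
      + brg x1 x2 (psi a1 a2 x3);
  mp_M2 : forall x1 x2 x3 a1 a2,
    - psi (rho x1 x2 a1) a2 x3 =
      - psi (rho x1 x3 a2) a1 x2 + psi (rho x2 x3 a2) a1 x1
      - brg x1 x2 (psi a1 a2 x3);
  mp_M3 : forall x1 x2 x3 a1 a2,
    brg (psi a1 a2 x1) x2 x3 =
      psi a1 a2 (brg x1 x2 x3) + psi (rho x2 x3 a1) a2 x1
      + psi a1 (rho x2 x3 a2) x1;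
  mp_M4 : forall x1 x2 a1 a2 a3,
    rho x1 x2 (brh a1 a2 a3) =
      brh (rho x1 x2 a1) a2 a3 + brh a1 (rho x1 x2 a2) a3
      + brh a1 a2 (rho x1 x2 a3);
  mp_M5 : forall x1 x2 a1 a2 a3,
    - rho (psi a1 a2 x1) x2 a3 =
      - rho (psi a1 a3 x2) x1 a2 + rho (psi a2 a3 x2) x1 a1
      - brh a1 a2 (rho x1 x2 a3);
  mp_M6 : forall x1 x2 a1 a2 a3,
    brh (rho x1 x2 a1) a2 a3 =
      rho x1 x2 (brh a1 a2 a3) + rho (psi a2 a3 x1) x2 a1
      + rho x1 (psi a2 a3 x2) a1
}.

Record is_matched_pair_representation (k : fieldType) (g h V W : lmodType k)
    (brg : g -> g -> g -> g) (brh : h -> h -> h -> h)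
    (rho : g -> g -> h -> h) (psi : h -> h -> g -> g)
    (rhoV : g -> g -> V -> V) (psiV : h -> h -> V -> V)
    (rhoW : g -> g -> W -> W) (psiW : h -> h -> W -> W)
    (alpha : V -> g -> h -> W) (beta : W -> h -> g -> V) :
    Prop := IsMatchedPairRepresentation {
  mpr_rhoV : is_representation brg rhoV;
  mpr_psiV : is_representation brh psiV;
  mpr_rhoW : is_representation brg rhoW;
  mpr_psiW : is_representation brh psiW;
  mpr_alpha : trilinear alpha;
  mpr_beta : trilinear beta;
  mpr_R1 : forall x1 x2 a1 a2 v,
    psiV a1 a2 (rhoV x1 x2 v) =
      rhoV (psi a1 a2 x1) x2 v + rhoV x1 (psi a1 a2 x2) v
      + rhoV x1 x2 (psiV a1 a2 v);
  mpr_R2 : forall x1 x2 x3 a1 a2 w1 w2,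
    let B x := beta w1 a2 x - beta w2 a1 x in
    B (brg x1 x2 x3) =
      rhoV x2 x3 (B x1) + rhoV x3 x1 (B x2) + rhoV x1 x2 (B x3);
  mpr_R3 : forall x1 x2 a1 a2 v,
    rhoV x1 (psi a1 a2 x2) v = psiV (rho x1 x2 a2) a1 v;
  mpr_R4 : forall x1 x2 a1 a2 v,
    rhoV x1 x2 (psiV a1 a2 v) = psiV (rho x1 x2 a1) a2 v;
  mpr_R5 : forall x1 x2 x3 a1 a2 v1 v2 v3 w1 w2,
    rhoV x1 x2 (beta w1 a2 x3 - beta w2 a1 x3) =
      beta (rhoW x2 x3 w2 + (alpha v2 x3 a2 - alpha v3 x2 a2)) a1 x1
      - beta w1 (rho x2 x3 a2) x1
      - beta (rhoW x1 x3 w2 + (alpha v1 x3 a2 - alpha v3 x1 a2)) a1 x2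
      + beta w1 (rho x1 x3 a2) x2
      + beta (rhoW x1 x2 w1 + (alpha v1 x2 a1 - alpha v2 x1 a1)) a2 x3
      - beta w2 (rho x1 x2 a1) x3;
  mpr_R6 : forall x1 x2 a1 a2 v,
    rhoV x1 x2 (psiV a1 a2 v) =
      psiV a1 a2 (rhoV x1 x2 v) + psiV (rho x1 x2 a1) a2 v
      + psiV a1 (rho x1 x2 a2) v;
  mpr_R7 : forall x1 x2 x3 a1 a2 v2 v3 w1 w2,
    rhoV x2 x3 (beta w1 a2 x1 - beta w2 a1 x1) =
      (beta w1 a2 (brg x1 x2 x3) - beta w2 a1 (brg x1 x2 x3))
      - beta w2 (rho x2 x3 a1) x1
      + beta w1 (rho x2 x3 a2) x1
      + beta (rhoW x2 x3 w1 + (alpha v2 x3 a1 - alpha v3 x2 a1)) a2 x1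
      - beta (rhoW x2 x3 w2 + (alpha v2 x3 a2 - alpha v3 x2 a2)) a1 x1;
  mpr_R8 : forall x1 x2 a1 a2 v,
    rhoV (psi a1 a2 x1) x2 v = psiV a1 a2 (rhoV x1 x2 v);
  mpr_R9 : forall x1 x2 a1 a2 w,
    rhoW x1 x2 (psiW a1 a2 w) =
      psiW (rho x1 x2 a1) a2 w + psiW a1 (rho x1 x2 a2) w
      + psiW a1 a2 (rhoW x1 x2 w);
  mpr_R10 : forall x1 x2 a1 a2 a3 v1 v2,
    let A a := alpha v1 x2 a - alpha v2 x1 a in
    A (brh a1 a2 a3) =
      psiW a2 a3 (A a1) + psiW a3 a1 (A a2) + psiW a1 a2 (A a3);
  mpr_R11 : forall x1 x2 a1 a2 w,
    psiW a1 (rho x1 x2 a2) w = rhoW (psi a1 a2 x2) x1 w;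
  mpr_R12 : forall x1 x2 a1 a2 w,
    psiW a1 a2 (rhoW x1 x2 w) = rhoW (psi a1 a2 x1) x2 w;
  mpr_R13 : forall x1 x2 a1 a2 a3 v1 v2 w1 w2 w3,
    psiW a1 a2 (alpha v1 x2 a3 - alpha v2 x1 a3) =
      alpha (psiV a2 a3 v2 + (beta w2 a3 x2 - beta w3 a2 x2)) x1 a1
      - alpha v1 (psi a2 a3 x2) a1
      - alpha (psiV a1 a3 v2 + (beta w1 a3 x2 - beta w3 a1 x2)) x1 a2
      + alpha v1 (psi a1 a3 x2) a2
      + alpha (psiV a1 a2 v1 + (beta w1 a2 x1 - beta w2 a1 x1)) x2 a3
      - alpha v2 (psi a1 a2 x1) a3;
  mpr_R14 : forall x1 x2 a1 a2 w,
    psiW a1 a2 (rhoW x1 x2 w) =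
      rhoW x1 x2 (psiW a1 a2 w) + rhoW (psi a1 a2 x1) x2 w
      + rhoW x1 (psi a1 a2 x2) w;
  mpr_R15 : forall x1 x2 a1 a2 a3 v1 v2 w2 w3,
    psiW a2 a3 (alpha v1 x2 a1 - alpha v2 x1 a1) =
      (alpha v1 x2 (brh a1 a2 a3) - alpha v2 x1 (brh a1 a2 a3))
      - alpha v2 (psi a2 a3 x1) a1
      + alpha v1 (psi a2 a3 x2) a1
      + alpha (psiV a2 a3 v1 + (beta w2 a3 x1 - beta w3 a2 x1)) x2 a1
      - alpha (psiV a2 a3 v2 + (beta w2 a3 x2 - beta w3 a2 x2)) x1 a1;
  mpr_R16 : forall x1 x2 a1 a2 w,
    psiW (rho x1 x2 a1) a2 w = rhoW x1 x2 (psiW a1 a2 w)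
}.

(* The bracket of g |x V on the direct sum, modelled by [(g * V)%type]. *)
Definition semidirect_bracket (k : fieldType) (g V : lmodType k)
    (br : g -> g -> g -> g) (rhoV : g -> g -> V -> V)
    (p1 p2 p3 : g * V) : g * V :=
  (br p1.1 p2.1 p3.1,
   rhoV p1.1 p2.1 p3.2 + rhoV p3.1 p1.1 p2.2 + rhoV p2.1 p3.1 p1.2).

(* Both rho |x alpha and psi |x beta are instances of this map; for the latter
   the roles of (g, V) and (h, W) are exchanged. *)
Definition semidirect_action (k : fieldType) (g h V W : lmodType k)
    (rho : g -> g -> h -> h) (rhoW : g -> g -> W -> W)
    (alpha : V -> g -> h -> W) (p1 p2 : g * V) (q : h * W) : h * W :=
  (rho p1.1 p2.1 q.1,
   rhoW p1.1 p2.1 q.2 + (alpha p1.2 p2.1 q.1 - alpha p2.2 p1.1 q.1)).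

(* Main.v *)
Require Import Defs.
From HB Require Import structures.
From mathcomp Require Import all_boot all_order all_algebra.
Import GRing.Theory.
Local Open Scope ring_scope.

(* Written componentwise, each of (M1)-(M3) for the semidirect products splits
   into the same axiom for the original data and an identity in [V].  The
   latter separates, by linearity, into its coefficients of the individual
   [V]-variables and a remainder linear in [beta]: the coefficients are
   (R1), (R3), (R4), (R6), (R8) and the remainders are (R2), (R5), (R7).
   The exchange of (g, V, rho, alpha) with (h, W, psi, beta) maps (M1)-(M3) to
   (M4)-(M6) and (R1)-(R8) to (R9)-(R16), so only half has to be checked. *)

(* Equality in an abelian group: every summand of the difference of the two
   sides is brought next to its opposite and cancelled.  The trailing [0] keeps
   each summand in the head position of some addition. *)
Ltac zmod :=
  apply/eqP; rewrite -subr_eq0 -[_ - _]addr0 !(opprD, opprK, oppr0) -!addrA;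
  repeat match goal with
  | |- is_true (- ?a + _ == 0) => rewrite !(addrCA _ a) addNKr
  | |- is_true (?a + _ == 0) => rewrite !(addrCA _ (- a)) addKr
  end; exact: eqxx.

Section Trilinear.
Context {k : fieldType} {A B C D : lmodType k} {f : A -> B -> C -> D}.
Hypothesis f_lin : trilinear f.

Lemma trilinearPl c a a' x y : f (c *: a + a') x y = c *: f a x y + f a' x y.
Proof. by case: f_lin => /(_ x y c a a'). Qed.

Lemma trilinearPm c b b' x y : f x (c *: b + b') y = c *: f x b y + f x b' y.
Proof. by case: f_lin => _ /(_ x y c b b'). Qed.

Lemma trilinearPr c d d' x y : f x y (c *: d + d') = c *: f x y d + f x y d'.
Proof. by case: f_lin => _ _ /(_ x y c d d'). Qed.

Lemma trilinearDl a a' x y : f (a + a') x y = f a x y + f a' x y.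
Proof. by rewrite -[a]scale1r trilinearPl !scale1r. Qed.

Lemma trilinearDm b b' x y : f x (b + b') y = f x b y + f x b' y.
Proof. by rewrite -[b]scale1r trilinearPm !scale1r. Qed.

Lemma trilinearDr d d' x y : f x y (d + d') = f x y d + f x y d'.
Proof. by rewrite -[d]scale1r trilinearPr !scale1r. Qed.

Lemma trilinearNr d x y : f x y (- d) = - f x y d.
Proof.
have f0: f x y 0 = 0 by apply: (addrI (f x y 0)); rewrite -trilinearDr !addr0.
by apply/eqP; rewrite -addr_eq0 -trilinearDr addNr f0.
Qed.

End Trilinear.

Lemma alternating12N {k : fieldType} {A C D : lmodType k}
    {f : A -> A -> C -> D} (f_lin : trilinear f) (f_alt : alternating12 f)
    a b c : f a b c = - f b a c.
Proof.
apply/eqP; rewrite -addr_eq0; apply/eqP; have := f_alt (a + b) c.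
by rewrite (trilinearDl f_lin) !(trilinearDm f_lin) !f_alt add0r addr0.
Qed.

Section SemidirectBracket.
Context {k : fieldType} {g V : lmodType k}.
Context {br : g -> g -> g -> g} {rhoV : g -> g -> V -> V}.
Hypotheses (br_lie : is_3Lie br) (V_rep : is_representation br rhoV).

Let br_lin := lie3_trilinear br_lie.
Let rhoV_lin := rep_trilinear V_rep.
Let rhoVN := alternating12N rhoV_lin (rep_alt V_rep).

Lemma semidirect_bracket_trilinear :
  @trilinear k _ _ _ (g * V)%type (semidirect_bracket br rhoV).
Proof.
by split=> p q c [x v] [y w]; congr (_, _);
   rewrite /= ?(trilinearPl br_lin) ?(trilinearPm br_lin) ?(trilinearPr br_lin)
     ?(trilinearPl rhoV_lin) ?(trilinearPm rhoV_lin) ?(trilinearPr rhoV_lin) //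
     !scalerDr (addrACA (c *: _)) (addrACA (c *: _ + c *: _)).
Qed.

Lemma semidirect_3Lie :
  @is_3Lie k (g * V)%type (semidirect_bracket br rhoV).
Proof.
have rhoV_alt := rep_alt V_rep.
split.
- exact: semidirect_bracket_trilinear.
- move=> [x v] [y w]; congr (_, _); rewrite /= ?(lie3_alt12 br_lie) //.
  by rewrite rhoV_alt add0r rhoVN addNr.
- move=> [x v] [y w]; congr (_, _); rewrite /= ?(lie3_alt13 br_lie) //.
  by rewrite rhoV_alt addr0 rhoVN addNr.
- move=> [x v] [y w]; congr (_, _); rewrite /= ?(lie3_alt23 br_lie) //.
  by rewrite rhoV_alt addr0 rhoVN addNr.
move=> [x1 u1] [x2 u2] [y1 v1] [y2 v2] [y3 v3].
congr (_, _); first exact: (lie3_fundamental br_lie).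
rewrite /= !(trilinearDr rhoV_lin).
have comm a b v : rhoV x1 x2 (rhoV a b v) =
    rhoV a b (rhoV x1 x2 v) + rhoV (br x1 x2 a) b v + rhoV a (br x1 x2 b) v.
  by rewrite -addrA -(rep_comm V_rep) addrCA subrr addr0.
have brac x u : rhoV (br y1 y2 y3) x u = rhoV y2 y3 (rhoV y1 x u)
    + rhoV y3 y1 (rhoV y2 x u) + rhoV y1 y2 (rhoV y3 x u).
  by rewrite (rep_bracket V_rep) -addrA addrC.
rewrite !comm (rhoVN x2 (br _ _ _)) !brac !(rhoVN _ x2) !(trilinearNr rhoV_lin).
zmod.
Qed.

End SemidirectBracket.

Section SemidirectAction.
Context {k : fieldType} {g h V W : lmodType k}.
Context {rho : g -> g -> h -> h} {rhoW : g -> g -> W -> W}.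
Context {alpha : V -> g -> h -> W}.

Lemma semidirect_action_trilinear :
  trilinear rho -> trilinear rhoW -> trilinear alpha ->
  @trilinear k (g * V)%type (g * V)%type (h * W)%type (h * W)%type
    (semidirect_action rho rhoW alpha).
Proof.
move=> rho_lin rhoW_lin alpha_lin.
split=> p q c [x v] [y w]; congr (_, _);
  rewrite /= ?(trilinearPl rho_lin) ?(trilinearPm rho_lin)
    ?(trilinearPr rho_lin) ?(trilinearPl rhoW_lin) ?(trilinearPm rhoW_lin)
    ?(trilinearPr rhoW_lin) ?(trilinearPl alpha_lin) ?(trilinearPm alpha_lin)
    ?(trilinearPr alpha_lin) // !scalerDr scalerN; zmod.
Qed.

Lemma semidirect_action_alternating :
  alternating12 rho -> alternating12 rhoW ->
  @alternating12 k (g * V)%type (h * W)%type (h * W)%type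
    (semidirect_action rho rhoW alpha).
Proof.
move=> rho_alt rhoW_alt [x v] [a w]; congr (_, _); rewrite /= ?rho_alt //.
by rewrite rhoW_alt subrr addr0.
Qed.

End SemidirectAction.

Section Symmetry.
Context {k : fieldType} {g h V W : lmodType k}.
Context {brg : g -> g -> g -> g} {brh : h -> h -> h -> h}.
Context {rho : g -> g -> h -> h} {psi : h -> h -> g -> g}.
Context {rhoV : g -> g -> V -> V} {psiV : h -> h -> V -> V}.
Context {rhoW : g -> g -> W -> W} {psiW : h -> h -> W -> W}.
Context {alpha : V -> g -> h -> W} {beta : W -> h -> g -> V}.

Lemma matched_pair_sym :
  is_matched_pair brg brh rho psi -> is_matched_pair brh brg psi rho.
Proof. by case=> *; split=> *; auto. Qed.

Lemma matched_pair_representation_sym :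
  is_matched_pair_representation
    brg brh rho psi rhoV psiV rhoW psiW alpha beta ->
  is_matched_pair_representation
    brh brg psi rho psiW rhoW psiV rhoV beta alpha.
Proof.
move=> R; split=> *.
all: by [exact: (mpr_R2 R) | exact: (mpr_R10 R) | case: R; auto].
Qed.

End Symmetry.

Section Compatibility.
Context {k : fieldType} {g h V W : lmodType k}.
Context {brg : g -> g -> g -> g} {brh : h -> h -> h -> h}.
Context {rho : g -> g -> h -> h} {psi : h -> h -> g -> g}.
Context {rhoV : g -> g -> V -> V} {psiV : h -> h -> V -> V}.
Context {rhoW : g -> g -> W -> W} {psiW : h -> h -> W -> W}.
Context {alpha : V -> g -> h -> W} {beta : W -> h -> g -> V}.
Hypothesis Hmp : is_matched_pair brg brh rho psi.
Hypothesis Hrep : is_matched_pair_representation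
  brg brh rho psi rhoV psiV rhoW psiW alpha beta.

Let rhoV_lin := rep_trilinear (mpr_rhoV Hrep).
Let psiV_lin := rep_trilinear (mpr_psiV Hrep).
Let rhoVN := alternating12N rhoV_lin (rep_alt (mpr_rhoV Hrep)).

Notation brgV := (semidirect_bracket brg rhoV).
Notation rho_alpha := (semidirect_action rho rhoW alpha).
Notation psi_beta := (semidirect_action psi psiV beta).

Implicit Types (p : g * V) (q : h * W).

Lemma semidirect_M1 p1 p2 p3 q1 q2 :
  psi_beta q1 q2 (brgV p1 p2 p3) =
    brgV (psi_beta q1 q2 p1) p2 p3 + brgV p1 (psi_beta q1 q2 p2) p3
    + brgV p1 p2 (psi_beta q1 q2 p3) :> (g * V)%type.
Proof.
case: p1 p2 p3 q1 q2 => [x1 v1] [x2 v2] [x3 v3] [a1 w1] [a2 w2].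
congr (_, _); first exact: (mp_M1 Hmp).
rewrite /= (mpr_R2 Hrep) !(trilinearDr psiV_lin) !(mpr_R1 Hrep).
rewrite !(trilinearDr rhoV_lin).
zmod.
Qed.

Lemma semidirect_M2 p1 p2 p3 q1 q2 :
  - psi_beta (rho_alpha p1 p2 q1) q2 p3 =
    - psi_beta (rho_alpha p1 p3 q2) q1 p2 + psi_beta (rho_alpha p2 p3 q2) q1 p1
    - brgV p1 p2 (psi_beta q1 q2 p3) :> (g * V)%type.
Proof.
case: p1 p2 p3 q1 q2 => [x1 v1] [x2 v2] [x3 v3] [a1 w1] [a2 w2].
congr (_, _); first exact: (mp_M2 Hmp).
rewrite /= (trilinearDr rhoV_lin) (mpr_R5 Hrep _ _ _ _ _ v1 v2 v3).
rewrite (mpr_R4 Hrep) (mpr_R3 Hrep) (rhoVN (psi _ _ _)) (mpr_R3 Hrep).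
zmod.
Qed.

Lemma semidirect_M3 p1 p2 p3 q1 q2 :
  brgV (psi_beta q1 q2 p1) p2 p3 =
    psi_beta q1 q2 (brgV p1 p2 p3) + psi_beta (rho_alpha p2 p3 q1) q2 p1
    + psi_beta q1 (rho_alpha p2 p3 q2) p1 :> (g * V)%type.
Proof.
case: p1 p2 p3 q1 q2 => [x1 v1] [x2 v2] [x3 v3] [a1 w1] [a2 w2].
congr (_, _); first exact: (mp_M3 Hmp).
rewrite /= (trilinearDr rhoV_lin) (mpr_R7 Hrep _ _ _ _ _ v2 v3).
rewrite (rhoVN x3) !(mpr_R8 Hrep) (mpr_R6 Hrep) !(trilinearDr psiV_lin).
rewrite (rhoVN x3 x1) (trilinearNr psiV_lin).
zmod.
Qed.

End Compatibility.

Theorem theorem2p4 (k : fieldType) (g h V W : lmodType k)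
    (brg : g -> g -> g -> g) (brh : h -> h -> h -> h)
    (rho : g -> g -> h -> h) (psi : h -> h -> g -> g)
    (rhoV : g -> g -> V -> V) (psiV : h -> h -> V -> V)
    (rhoW : g -> g -> W -> W) (psiW : h -> h -> W -> W)
    (alpha : V -> g -> h -> W) (beta : W -> h -> g -> V)
    (Hmp : is_matched_pair brg brh rho psi)
    (Hrep : is_matched_pair_representation
              brg brh rho psi rhoV psiV rhoW psiW alpha beta) :
  @is_matched_pair k (g * V)%type (h * W)%type
    (semidirect_bracket brg rhoV) (semidirect_bracket brh psiW)
    (semidirect_action rho rhoW alpha) (semidirect_action psi psiV beta).
Proof.
have Hmp' := matched_pair_sym Hmp.
have Hrep' := matched_pair_representation_sym Hrep.
split.
- exact: semidirect_3Lie (mp_3Lie_l Hmp) (mpr_rhoV Hrep).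
- exact: semidirect_3Lie (mp_3Lie_r Hmp) (mpr_psiW Hrep).
- exact: semidirect_action_trilinear (mp_rho_trilinear Hmp)
    (rep_trilinear (mpr_rhoW Hrep)) (mpr_alpha Hrep).
- exact: semidirect_action_alternating (mp_rho_alt Hmp)
    (rep_alt (mpr_rhoW Hrep)).
- exact: semidirect_action_trilinear (mp_psi_trilinear Hmp)
    (rep_trilinear (mpr_psiV Hrep)) (mpr_beta Hrep).
- exact: semidirect_action_alternating (mp_psi_alt Hmp)
    (rep_alt (mpr_psiV Hrep)).
- exact: semidirect_M1 Hmp Hrep.
- exact: semidirect_M2 Hmp Hrep.
- exact: semidirect_M3 Hmp Hrep.
- by move=> *; apply: (semidirect_M1 Hmp' Hrep').
- by move=> *; apply: (semidirect_M2 Hmp' Hrep').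
- by move=> *; apply: (semidirect_M3 Hmp' Hrep').
Qed.
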